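(* Let $\mathcal{G}$ be a directed acyclic graph (DAG) on the node set $[n]$. The DAG associahedron associated to $\mathcal{G}$ is MSS (can be realized as a Minkowski sum of standard simplices) if and only if $\mathcal{G}$ does not contain any V-structures, i.e. if and only if the DAG model coincides with an undirected graphical model (the DAG gaussoid of $\mathcal{G}$ is equal to the set of conditional independence relations given by separation in some undirected graph on $[n]$).
   Context: Notation: $[n]=\{1,\dots,n\}$; concatenation denotes union, e.g. $Kij=K\cup\{i,j\}$. V-structure: a triple of nodes $(i,j,k)$ with $i\neq j$, $i\to k\leftarrow j$ in $\mathcal{G}$ and $i,j$ not adjacent in $\mathcal{G}$. DAG gaussoid. A path in $\mathcal{G}$ is an alternating sequence of nodes and edges, each edge joining its neighbors in the sequence; nodes and edges may be repeated and edges may be traversed in either direction. For distinct $i,j\in[n]$ and $K\subseteq[n]\setminus\{i,j\}$, a Bayes ball path from $i$ to $j$ given $K$ is a path from $i$ to $j$ such that (1) if $a\to b\to c$, $a\leftarrow b\to c$ or $a\leftarrow b\leftarrow c$ occurs on the path, then $b\notin K$; (2) if $a\to b\leftarrow c$ occurs on the path ($a=c$ allowed), then $b\in K$. The DAG gaussoid of $\mathcal{G}$ is the set of all formal relations $i\perp\!\!\!\perp j\mid K$ for which there is no Bayes ball path from $i$ to $j$ given $K$. In an undirected graph on $[n]$, separation gives the relations $i\perp\!\!\!\perp j\mid K$ such that every path between $i$ and $j$ passes through a node of $K$. $S_n$ fan. Its maximal cones are $C_\pi=\{u\in\mathbb{R}^n:u_{\pi(1)}\ge\dots\ge u_{\pi(n)}\}$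 for permutations $\pi=(\pi(1)|\cdots|\pi(n))$ of $[n]$. The relation $i\perp\!\!\!\perp j\mid K$ corresponds to the walls shared by the cones of $(a_1|\cdots|a_k|i|j|b_1|\cdots|b_{n-k-2})$ and $(a_1|\cdots|a_k|j|i|b_1|\cdots|b_{n-k-2})$ with $\{a_1,\dots,a_k\}=K$, $\{b_1,\dots,b_{n-k-2}\}=[n]\setminus Kij$. Removing all walls corresponding to the relations of the DAG gaussoid gives a complete fan coarsening the $S_n$ fan; its maximal cones are unions of the $C_\pi$ over the classes of permutations connected through removed walls. A DAG associahedron of $\mathcal{G}$ is any polytope whose outer normal fan (cones of linear functionals maximized on faces) is this coarsened fan; it exists and is uniquely defined up to equality of normal fans. MSS. The standard simplices are $\Delta_I=\mathrm{conv}\{e_i:i\in I\}\subset\mathbb{R}^n$ for nonempty $I\subseteq[n]$. The DAG associahedron is MSS if the coarsened fan above is the outer normal fan of a Minkowski sum of standard simplices $\Delta_I$, for some collection of nonempty subsets $I\subseteq[n]$. *)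

(* Defs.v *)
From Stdlib Require Import Relation_Operators.
From mathcomp Require Import all_boot all_order all_algebra perm.
From mathcomp Require Import classical_sets reals.

Set Implicit Arguments.
Unset Strict Implicit.
Unset Printing Implicit Defensive.

Import Order.TTheory GRing.Theory Num.Theory.

Local Open Scope classical_set_scope.
Local Open Scope ring_scope.

(* The node set [n] is 'I_n, and [G a b] means that there is an edge a -> b. *)

Definition acyclic n (G : rel 'I_n) : Prop :=
  forall c : seq 'I_n, path.cycle G c -> c = [::].

Definition adjacent n (G : rel 'I_n) : rel 'I_n := [rel a b | G a b || G b a].

Definition v_structure n (G : rel 'I_n) (i j k : 'I_n) : Prop :=
  [/\ i != j, G i k, G j k & ~~ adjacent G i j].

(* The formal relation "i independent of j given K" is the triple (i, j, K). *)
Definition relation_triple n : Type := ('I_n * 'I_n * {set 'I_n})%type.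

Definition is_relation n (t : relation_triple n) : Prop :=
  let: (i, j, K) := t in [/\ i != j, i \notin K & j \notin K].

(* The path is [i :: p].  Two nodes of an acyclic graph are joined by at most
   one edge, so the nodes of a path determine its edges.  Nodes may repeat. *)
Definition bayes_ball_path n (G : rel 'I_n) (K : {set 'I_n}) (i j : 'I_n)
    (p : seq 'I_n) : Prop :=
  [/\ path (adjacent G) i p, last i p = j &
      forall a b c : 'I_n, infix [:: a; b; c] (i :: p) ->
        ([|| G a b && G b c, G b a && G b c | G b a && G c b] -> b \notin K) /\
        (G a b && G c b -> b \in K)].

Definition dag_gaussoid n (G : rel 'I_n) : set (relation_triple n) :=
  [set t | is_relation t /\
     let: (i, j, K) := t in ~ exists p, bayes_ball_path G K i j p].

Definition separation_relations n (H : rel 'I_n) : set (relation_triple n) :=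
  [set t | is_relation t /\
     let: (i, j, K) := t in
     forall p : seq 'I_n, path H i p -> last i p = j ->
       exists2 x, x \in i :: p & x \in K].

Definition is_undirected_model n (M : set (relation_triple n)) : Prop :=
  exists H : rel 'I_n,
    [/\ symmetric H, irreflexive H & M = separation_relations H].

Section Polyhedra.
Context {R : realType} {n : nat}.
Implicit Types (P F : set 'rV[R]_n) (u x : 'rV[R]_n).

Definition dot u x : R := \sum_(k < n) u 0 k * x 0 k.

Definition argmax P u : set 'rV[R]_n :=
  [set x | P x /\ forall y, P y -> dot u y <= dot u x].

(* On a polyhedral cone C a functional attains its maximum iff it is <= 0 on C,
   so this also gives the usual faces of C, including C itself. *)
Definition faces P : set (set 'rV[R]_n) :=
  [set F | F !=set0 /\ exists u, F = argmax P u].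

Definition normal_cone P F : set 'rV[R]_n := [set u | F `<=` argmax P u].

Definition outer_normal_fan P : set (set 'rV[R]_n) :=
  [set normal_cone P F | F in faces P].

Definition perm_cone (s : 'S_n) : set 'rV[R]_n :=
  [set u : 'rV[R]_n | forall k l : 'I_n, (k <= l)%N -> u 0 (s l) <= u 0 (s k)].

(* [codom s] is the word (s(1)|...|s(n)). *)
Definition removed_wall (M : set (relation_triple n)) (s t : 'S_n) : Prop :=
  exists (a b : seq 'I_n) (i j : 'I_n),
    [/\ codom s = a ++ [:: i; j] ++ b, codom t = a ++ [:: j; i] ++ b &
        M (i, j, [set x in a]%SET)].

Definition coarsened_cone (M : set (relation_triple n)) (s : 'S_n) :
    set 'rV[R]_n :=
  \bigcup_(t in [set t | clos_refl_sym_trans _ (removed_wall M) s t])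
    perm_cone t.

(* A fan is the set of all faces of its maximal cones. *)
Definition coarsened_fan (M : set (relation_triple n)) : set (set 'rV[R]_n) :=
  \bigcup_(s in [set: 'S_n]) faces (coarsened_cone M s).

Definition std_simplex (I : {set 'I_n}) : set 'rV[R]_n :=
  [set x | exists c : 'I_n -> R,
     [/\ forall i, i \in I -> 0 <= c i, \sum_(i in I) c i = 1 &
         x = \sum_(i in I) c i *: delta_mx 0 i]].

Definition minkowski_sum (S : {set {set 'I_n}})
    (A : {set 'I_n} -> set 'rV[R]_n) : set 'rV[R]_n :=
  [set x | exists2 f : {set 'I_n} -> 'rV[R]_n,
     forall I, I \in S -> A I (f I) & x = \sum_(I in S) f I].

End Polyhedra.

Definition is_MSS (R : realType) n (G : rel 'I_n) : Prop :=
  exists2 S : {set {set 'I_n}}, finset.set0 \notin S &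
    outer_normal_fan (minkowski_sum S (@std_simplex R n))
      = coarsened_fan (dag_gaussoid G).

(* Main.v *)
(* In the normal fan of a sum of simplices Delta_I, I in S, the wall of the
   relation i _||_ j | K is present iff some I in S contains i and j and avoids
   K.  Hence the relations of such a fan persist when K grows, as they do for
   separation in an undirected graph.  A V-structure i -> k <- j violates this:
   the parents of one of i, j separate them, and adding k opens the path i, k, j.
   Passing from the fan to its walls uses that a wall which is not removed has
   its two sides in different classes of permutations, because the minimal
   I-map of a permutation is constant on classes.
   Without V-structures the gaussoid is separation in the skeleton, and one can
   take for S the connected sets of nodes. *)
From Stdlib Require Import Relation_Operators.
Require Import Defs.
From mathcomp Require Import all_boot all_order all_algebra perm.
From mathcomp Require Import boolp classical_sets reals lra zify.

Set Implicit Arguments.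
Unset Strict Implicit.
Unset Printing Implicit Defensive.

Import Order.TTheory GRing.Theory Num.Theory.

(** * Bayes ball paths *)

Section BayesBall.
Variables (n : nat) (G : rel 'I_n).
Implicit Types (i j k : 'I_n) (K : {set 'I_n}) (p : seq 'I_n).

Definition bayes_connected K i j := exists p, bayes_ball_path G K i j p.

Definition parents j : {set 'I_n} := [set x | G x j]%SET.

(** Both ends of an edge must avoid [K], so that walks outside [K] are plain reachability and
    [connect] applies. *)
Definition skeleton_avoiding K : rel 'I_n :=
  [rel a b | [&& adjacent G a b, a \notin K & b \notin K]].

Lemma adjacent_sym : symmetric (adjacent G).
Proof. by move=> a b; rewrite /adjacent /= orbC. Qed.

Lemma path_skeleton_avoiding K i p : i \notin K ->
  path (skeleton_avoiding K) i p = path (adjacent G) i p && all [predC K] p.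
Proof.
elim: p i => //= b p IH i iK; have [bK|bK] := boolP (b \in K).
  by rewrite /skeleton_avoiding /= bK !andbF.
by rewrite /skeleton_avoiding /= iK bK !andbT -andbA -IH.
Qed.

Lemma bayes_ball_path_suffix K i j p1 y p2 :
  bayes_ball_path G K i j (p1 ++ y :: p2) -> bayes_ball_path G K y j p2.
Proof.
case; rewrite cat_path last_cat => + + act => /andP[_ /= /andP[_ pp2]] lp.
split=> // a b c /infixP [s1 [s2 e]]; apply: act; apply/infixP.
by exists (i :: p1 ++ s1), s2; rewrite e /= -catA.
Qed.

Lemma bayes_connected_sym K i j : bayes_connected K i j -> bayes_connected K j i.
Proof.
case=> p [pp lp act]; exists (rev (belast i p)).
have e : rev (i :: p) = j :: rev (belast i p) by rewrite lastI lp rev_rcons.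
split.
- rewrite -lp rev_path; apply: sub_path pp => a b.
  by rewrite adjacent_sym.
- by case: p lp {pp act e} => [//|a p] _; rewrite /= rev_cons last_rcons.
- move=> a b c; rewrite -e -infix_rev revK => /act [h1 h2].
  split=> [h|/andP[h h']]; last by apply: h2; rewrite h h'.
  by apply: h1; case/or3P: h => /andP[-> ->]; rewrite ?orbT.
Qed.

(** Membership in [K] is tested only at the middle of a triple, hence never at an occurrence of the
    starting node in first position; the two sets may differ there. *)
Lemma bayes_ball_path_eq K K' i j p :
    {in p, K =i K'} -> bayes_ball_path G K i j p -> bayes_ball_path G K' i j p.
Proof.
move=> eK [pp lp act]; split=> // a b c abc.
have bp : b \in p.
  case/infixP: abc => [[|x s1] [s2 [_ ->]]]; first by rewrite inE eqxx.
  by rewrite mem_cat !inE eqxx !orbT.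
by rewrite -eK //; apply: act.
Qed.

(* Cut the walk at its last visit to [A]: afterwards it does not see whether
   nodes of [A] are conditioned on. *)
Lemma bayes_connected_last_visit (A : {set 'I_n}) K i j :
    i \in A -> bayes_connected K i j ->
  exists2 z, z \in A &
    forall K', {in [predC A], K =i K'} -> bayes_connected K' z j.
Proof.
move=> iA [p]; have [m] := ubnP (size p).
elim: m => // m IH in i iA p * => szp bp.
have [/hasP[y]|/hasPn noA] := boolP (has [in A] p).
  move=> yp yA; case/splitPr: yp szp bp => p1 p2 szp bp.
  apply: (IH y yA p2) (bayes_ball_path_suffix bp).
  by move: szp; rewrite size_cat /= ltnS; apply: leq_trans; rewrite leq_addl.
exists i => // K' eK; exists p; apply: bayes_ball_path_eq bp => x xp.
by apply: eK; apply: noA.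
Qed.

(** The walk is cut at its last visit to [x] or [z]. What remains starts at one of them and does not
    notice a change of the conditioning set at these two nodes. *)
Lemma bayes_connected_change K K1 K2 x z y :
    (forall w, w != x -> w != z -> (w \in K) = (w \in K1)) ->
    (forall w, w != x -> w != z -> (w \in K) = (w \in K2)) ->
  bayes_connected K x y -> bayes_connected K1 x y \/ bayes_connected K2 z y.
Proof.
move=> K1E K2E /(bayes_connected_last_visit (set21 x z))[w].
by rewrite !inE => /orP[]/eqP-> h; [left|right]; apply: h => u;
  rewrite !inE negb_or => /andP[ux uz]; [apply: K1E|apply: K2E].
Qed.

(** Nodes of [K] on the walk are colliders. Without V-structures the two neighbours of a collider
    are equal or adjacent, so the collider can be bypassed. *)
Lemma bayes_ball_path_connect K i j p :
    (forall i j k, ~ v_structure G i j k) -> i \notin K -> j \notin K ->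
  bayes_ball_path G K i j p -> connect (skeleton_avoiding K) i j.
Proof.
move=> noV + jK; have [m] := ubnP (size p).
elim: m => // m IH in i p *; case: p => [|b p] /= szp iK bp.
  by case: bp => _ /= ->.
have [bK|bK] := boolP (b \in K); last first.
  apply: (@connect_trans _ _ b).
    apply: connect1; rewrite /skeleton_avoiding /= iK bK !andbT.
    by case: bp => /andP[].
  exact: (IH b p szp bK (@bayes_ball_path_suffix _ _ _ [::] _ _ bp)).
case: p szp bp => [|c p] szp bp; first by case: bp jK => _ /= <- _; rewrite bK.
have bc : bayes_ball_path G K c j p.
  exact: (@bayes_ball_path_suffix _ i _ [:: b] _ _ bp).
case: bp => + + act => /= /and3P[ib bc' pp] lp.
have [act1 _] := act i b c (prefix_infix [:: i; b; c] p).
(* Since [b] lies in [K], the three non-collider patterns at [b] are excluded. *)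
have /andP[Gib Gcb] : G i b && G c b.
  have: ~~ [|| G i b && G b c, G b i && G b c | G b i && G c b].
    by apply/negP => /act1; rewrite bK.
  by move: ib bc'; rewrite /adjacent /=; case: (G i b); case: (G b i);
    case: (G b c); case: (G c b).
(* The edge [c -> b] leaves [c], so [c] is no collider in the next triple; if the walk ends there,
   [c] is [j]. *)
have cK : c \notin K.
  case: p pp lp bc act {szp act1} => [|d p]; first by move=> _ /= ->.
  case/andP=> cd _ _ _ act; have [] := act b c d.
    by apply/infixP; exists [:: i], p.
  by move=> h _; apply: h; move: cd; rewrite /adjacent /= Gcb /= => /orP[] ->;
    rewrite ?orbT.
apply: (@connect_trans _ _ c); last first.
  by apply: IH bc => //; apply: ltnW.
have [->//|ic] := eqVneq i c.
apply: connect1; rewrite /skeleton_avoiding /= iK cK !andbT.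
apply: contra_notT (noV i c b) => nic; split=> //.
Qed.

(** Induction on the length: a collider can be cut out of the walk, and a walk outside [K] without
    colliders is already a Bayes ball path. *)
Lemma path_skeleton_bayes_ball K i j p :
    (forall i j k, ~ v_structure G i j k) ->
    path (skeleton_avoiding K) i p -> last i p = j ->
  bayes_connected K i j.
Proof.
move=> noV; have [m] := ubnP (size p).
elim: m => // m IH in p * => szp pp lp.
have [//|nB] := pselect (bayes_connected K i j).
have [[a [b [c [abc Gab Gcb]]]]|nocol] :=
  pselect (exists a b c, [/\ infix [:: a; b; c] (i :: p), G a b & G c b]).
  case/infixP: abc => s1 [s2 e].
  have /and3P[ab bc cs2] : path (skeleton_avoiding K) a [:: b, c & s2].
    by case: s1 e => [[<- <-]|x s1 [_ e]] //; move: pp; rewrite e cat_path => /and3P[].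
  (* [q] replaces the walk from [b] on: the detour [a, b, a] is dropped if [a = c], and otherwise
     the edge between [a] and [c] is used. *)
  have [q [pq lq szq]] : exists q, [/\ path (skeleton_avoiding K) a q,
      last a q = last c s2 & size q < (size s2).+2].
    have [eac|nac] := eqVneq a c; first by exists s2; rewrite eac ltnS leqnSn.
    exists (c :: s2); split=> //; apply/andP; split=> //.
    move: ab bc; rewrite /skeleton_avoiding /= => /and3P[_ -> _] /and3P[_ _ ->].
    by rewrite !andbT; apply: contra_notT (noV a c b) => nac'.
  case: s1 e => [[ia e]|x s1 [_ e]].
    subst i; apply: (IH q) => //; last by rewrite -lp e lq.
    by move: szp; rewrite e ltnS; apply: leq_trans.
  apply: (IH (s1 ++ a :: q)); last by rewrite -lp e !last_cat /= lq.
    move: szp; rewrite e !size_cat ltnS; apply: leq_trans.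
    by rewrite /= ltn_add2l.
  by move: pp; rewrite e !cat_path /= => /and3P[-> -> _].
exists p; split=> //.
- by apply: sub_path pp => a b /and3P[].
- move=> a b c abc; split; last by move=> /andP[Gab Gcb]; case: nocol; exists a, b, c.
  move=> _; case/infixP: abc => [[|x s1] [s2 [_ e]]]; move: pp; rewrite e.
    by case/andP=> /and3P[].
  by rewrite cat_path /= => /and4P[_ _ /and3P[]].
Qed.

Lemma bayes_connectedE K i j :
    (forall i j k, ~ v_structure G i j k) -> i \notin K -> j \notin K ->
  bayes_connected K i j <-> connect (skeleton_avoiding K) i j.
Proof.
move=> noV iK jK; split=> [[p]|/connectP[p pp lp]].
  exact: bayes_ball_path_connect.
exact: path_skeleton_bayes_ball pp _.
Qed.

Hypothesis acyclicG : acyclic G.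

Lemma acyclic_connect i j : connect G i j -> ~~ G j i.
Proof.
case/connectP=> p pp ->; apply/negP => Gji.
by have := @acyclicG (i :: p); rewrite /= rcons_path pp Gji => /(_ isT).
Qed.

Lemma acyclic_connect_anti i j : i != j -> connect G i j -> ~~ connect G j i.
Proof.
move=> ij cij; apply/negP => /connectP[p]; case/lastP: p => [|p k].
  by move=> _ /= e; rewrite e eqxx in ij.
rewrite rcons_path last_rcons => /andP[pp Gki] e; subst k.
have jl : connect G j (last j p) by apply/connectP; exists p.
by have := acyclic_connect (connect_trans cij jl); rewrite Gki.
Qed.

(* The separating walk would have to leave [j] along an outgoing edge, and
   then keep descending: a collider below [j] is not a parent of [j]. *)
Lemma parents_separate i j :
    i != j -> ~~ adjacent G i j -> ~~ connect G j i ->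
  ~ bayes_connected (parents j) i j.
Proof.
move=> ij nadj nji /bayes_connected_sym[p].
have descend : forall p z x, connect G j z -> G z x ->
    bayes_ball_path G (parents j) z i (x :: p) -> connect G j i.
  elim=> [|y q IH] z x jz zx bp.
    by case: bp => _ /= <- _; apply: connect_trans jz (connect1 zx).
  have jx : connect G j x by apply: connect_trans jz (connect1 zx).
  case: (bp) => /and3P[_ xy _] _ act.
  have [Gyx|nGyx] := boolP (G y x).
    have [_] := act z x y (prefix_infix [:: z; x; y] q).
    rewrite zx Gyx inE => /(_ isT) Gxj.
    by have := acyclic_connect jx; rewrite Gxj.
  apply: (IH x y jx); first by move: xy; rewrite /adjacent /= (negbTE nGyx) orbF.
  exact: (@bayes_ball_path_suffix _ z _ [::] x _ bp).
case: p => [|x p] bp.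
  by case: bp => _ /= e; rewrite e eqxx in ij.
have [Gxj|nGxj] := boolP (G x j); last first.
  move/negP: nji; apply; apply: (descend p j x) => //.
  case: bp => /= /andP[+ _] _ _.
  by rewrite /adjacent /= (negbTE nGxj) orbF.
case: p bp => [|y p] bp.
  case: bp => _ /= e _; subst x.
  by move: nadj; rewrite /adjacent /= Gxj.
case: bp => + _ act => /and3P[_ xy _].
(* The edge [x -> j] leaves [x], so [x] is not a collider, yet it is conditioned on as a parent of
   [j]. *)
have [+ _] := act j x y (prefix_infix [:: j; x; y] p).
rewrite inE Gxj /= => noK; apply/negP: isT; apply: noK.
by case/orP: xy => ->; rewrite ?orbT.
Qed.

Lemma v_structure_sym i j k : v_structure G i j k -> v_structure G j i k.
Proof. by case=> ij ik jk nadj; split; rewrite // ?(eq_sym j) ?(adjacent_sym j). Qed.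

(** By acyclicity one of the two parents of [k] is not a descendant of the other. With the labels
    chosen so that [j] does not reach [i], the parents of [j] separate, and [j -> k] keeps [k] out
    of them. *)
Lemma v_structure_separated i j k : v_structure G i j k ->
  exists i' j', [/\ v_structure G i' j' k,
    dag_gaussoid G (i', j', parents j') & k \notin parents j'].
Proof.
wlog nji : i j / ~~ connect G j i.
  move=> H v; have [cji|nji] := boolP (connect G j i); last exact: H nji v.
  apply: (H j i); last exact: v_structure_sym.
  by apply: acyclic_connect_anti cji; case: v; rewrite eq_sym.
move=> v; exists i, j; case: (v) => ij ik jk nadj; split=> //.
  split; last exact: parents_separate.
  split; rewrite ?inE //.
    by move: nadj; rewrite /adjacent /= negb_or => /andP[].
  exact: acyclic_connect.
by rewrite inE; apply: acyclic_connect; apply: connect1.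
Qed.

(** The walk [i, k, j] has a single triple, whose collider [k] is conditioned on. *)
Lemma v_structure_bayes_connected K i j k :
  v_structure G i j k -> bayes_connected (k |: K)%SET i j.
Proof.
case=> ij ik jk nadj; exists [:: k; j].
have nki : ~~ G k i by apply: acyclic_connect; apply: connect1.
have nkj : ~~ G k j by apply: acyclic_connect; apply: connect1.
split=> //; first by rewrite /= /adjacent /= ik jk orbT.
move=> a b c; rewrite /infix /= !andbT !orbF !andbF !orbF.
case/and3P=> /eqP-> /eqP-> /eqP->; rewrite (negbTE nki) (negbTE nkj) ik !andbF /=.
by split=> // _; rewrite setU11.
Qed.

Lemma ascending_no_v_structure :
    (forall i j K K', dag_gaussoid G (i, j, K) -> K \subset K' ->
      i \notin K' -> j \notin K' -> dag_gaussoid G (i, j, K')) ->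
  ~ exists i j k, v_structure G i j k.
Proof.
move=> asc [i0 [j0 [k v0]]].
have [i [j [v gK kK]]] := v_structure_separated v0.
case: (v) => ij ik jk nadj.
have [] := asc i j _ (k |: parents j)%SET gK (finset.subsetUr _ _).
- by rewrite !inE negb_or; case: gK => [[_ + _] _]; rewrite inE => ->; rewrite andbT;
    apply: contraTneq ik => ->; apply: acyclic_connect.
- by rewrite !inE negb_or; case: gK => [[_ _ +] _]; rewrite inE => ->; rewrite andbT;
    apply: contraTneq jk => ->; apply: acyclic_connect.
by move=> _; apply; apply: v_structure_bayes_connected v.
Qed.

End BayesBall.

(** * Normal fans of sums of simplices *)

Local Open Scope classical_set_scope.
Local Open Scope ring_scope.

Section Dot.
Variables (R : realType) (n : nat).
Implicit Types u v x y : 'rV[R]_n.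

Lemma dotC u x : dot u x = dot x u.
Proof. by apply: eq_bigr => k _; rewrite mulrC. Qed.

Lemma dotDr u x y : dot u (x + y) = dot u x + dot u y.
Proof. by rewrite -big_split; apply: eq_bigr => k _; rewrite mxE mulrDr. Qed.

Lemma dotZr u a x : dot u (a *: x) = a * dot u x.
Proof. by rewrite /dot mulr_sumr; apply: eq_bigr => k _; rewrite mxE mulrCA. Qed.

Lemma dot0r u : dot u 0 = 0.
Proof. by rewrite -(scale0r 0) dotZr mul0r. Qed.

Lemma dotBr u x y : dot u (x - y) = dot u x - dot u y.
Proof. by rewrite dotDr -scaleN1r dotZr mulN1r. Qed.

Lemma dot_sumr u (T : finType) (P : pred T) (f : T -> 'rV[R]_n) :
  dot u (\sum_(t | P t) f t) = \sum_(t | P t) dot u (f t).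
Proof. exact: (big_morph _ (dotDr u) (dot0r u)). Qed.

Lemma dot_delta u i : dot u (delta_mx 0 i) = u 0 i.
Proof.
rewrite /dot (bigD1 i) //= mxE !eqxx mulr1 big1 ?addr0 // => k ki.
by rewrite mxE (negbTE ki) andbF mulr0.
Qed.

End Dot.

(** * Normal cones of Minkowski sums *)

Section MinkowskiSum.
Variables (R : realType) (n : nat) (S : {set {set 'I_n}}).
Implicit Types (A : {set 'I_n} -> set 'rV[R]_n) (I : {set 'I_n}) (u v x : 'rV[R]_n).

(** A functional is additive over the summands; changing the summand at a single index shows that
    each one must be optimal. *)
Lemma argmax_minkowski_sumP A (g : {set 'I_n} -> 'rV[R]_n) u :
    (forall I, I \in S -> A I (g I)) ->
  argmax (minkowski_sum S A) u (\sum_(I in S) g I) <->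
  forall I, I \in S -> argmax (A I) u (g I).
Proof.
move=> Ag; split=> [[_ gmax] I IS|gmax]; last first.
  split; first by exists g.
  move=> _ [f Af ->]; rewrite !dot_sumr; apply: ler_sum => I IS.
  by have [_] := gmax I IS; apply; apply: Af.
split; first exact: Ag.
move=> y Ay; pose f J := if J == I then y else g J.
have /gmax : minkowski_sum S A (\sum_(J in S) f J).
  by exists f => // J JS; rewrite /f; case: eqP => [->|_] //; apply: Ag.
rewrite !(bigD1 I IS) /= !dotDr {1}/f eqxx.
rewrite (@eq_bigr _ _ _ _ _ (fun J => (J \in S) && (J != I)) f g) ?lerD2r //.
by move=> J /andP[_ /negbTE JI]; rewrite /f JI.
Qed.

Lemma argmax_minkowski_sum_subset A u v :
    (forall I w, I \in S -> argmax (A I) w !=set0) ->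
  argmax (minkowski_sum S A) u `<=` argmax (minkowski_sum S A) v <->
  forall I, I \in S -> argmax (A I) u `<=` argmax (A I) v.
Proof.
move=> A0; split=> [uv I IS x xmax|uv x xmax]; last first.
  case: (xmax) => -[g Ag ex] _; subst x.
  apply/argmax_minkowski_sumP => // I IS; apply: uv => //.
  by move/(argmax_minkowski_sumP u Ag): xmax; apply.
(* Maximizers in the other summands complete [x] to a maximizer in the sum; this is where attained
   maxima matter. The value 0 outside [S] is arbitrary. *)
have [h hmax] : exists h, forall J, J \in S -> argmax (A J) u (h J).
  have /choice[h hP] : forall J, exists y, J \in S -> argmax (A J) u y.
    move=> J; case: (boolP (J \in S)) => [JS|_]; last by exists 0.
    by case: (A0 J u JS) => y; exists y.
  by exists h.
pose g J := if J == I then x else h J.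
have gmax J : J \in S -> argmax (A J) u (g J).
  by rewrite /g; case: eqP => [->|_ /hmax].
have Ag J : J \in S -> A J (g J) by case/gmax.
have /(argmax_minkowski_sumP v Ag)/(_ I IS) :=
  uv _ ((argmax_minkowski_sumP u Ag).2 gmax).
by rewrite /g eqxx.
Qed.

Lemma outer_normal_fan_minkowski_sum A :
    (forall I w, I \in S -> argmax (A I) w !=set0) ->
  outer_normal_fan (minkowski_sum S A) =
  range (fun u => [set v | forall I, I \in S -> argmax (A I) u `<=` argmax (A I) v]).
Proof.
move=> A0.
have coneE u : normal_cone (minkowski_sum S A) (argmax (minkowski_sum S A) u) =
    [set v | forall I, I \in S -> argmax (A I) u `<=` argmax (A I) v].
  by apply/seteqP; split=> v; rewrite /normal_cone /= argmax_minkowski_sum_subset.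
apply/seteqP; split=> [_ [_ [_ [u ->]] <-]|_ [u _ <-]].
  by rewrite coneE; exists u.
exists (argmax (minkowski_sum S A) u) => //; split; last by exists u.
have /choice[g gP] : forall J, exists y, J \in S -> argmax (A J) u y.
  move=> J; case: (boolP (J \in S)) => [JS|_]; last by exists 0.
  by case: (A0 J u JS) => y; exists y.
exists (\sum_(I in S) g I); apply/argmax_minkowski_sumP => I /gP //.
by case.
Qed.

End MinkowskiSum.

(** * Faces of standard simplices *)

Section SimplexSums.
Variables (R : realType) (n : nat).
Implicit Types (I : {set 'I_n}) (u v x : 'rV[R]_n).

(** These index the vertices of the face of the simplex on [I] in direction [u]. *)
Definition top I u : {set 'I_n} :=
  [set i in I | [forall l in I, u 0 l <= u 0 i]]%SET.

Lemma topP I u i :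
  reflect (i \in I /\ forall l, l \in I -> u 0 l <= u 0 i) (i \in top I u).
Proof. by rewrite inE; apply: (iffP andP) => -[? /forall_inP]. Qed.

Lemma top_neq0 I u : I != finset.set0 -> exists i, i \in top I u.
Proof.
case/set0Pn => i0 i0I; pose i := [arg max_(i > i0 in I) u 0 i]%O.
by exists i; apply/topP; rewrite /i; case: arg_maxP.
Qed.

Lemma delta_std_simplex I i : i \in I -> std_simplex I (delta_mx 0 i : 'rV[R]_n).
Proof.
move=> iI; exists (fun l => (l == i)%:R); split=> [l _||].
- exact: ler0n.
- by rewrite (bigD1 i) //= eqxx big1 ?addr0 // => l /andP[_ /negbTE ->].
- rewrite (bigD1 i) //= eqxx scale1r big1 ?addr0 // => l /andP[_ /negbTE ->].
  by rewrite scale0r.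
Qed.

Lemma dot_std_simplex_le I u x m :
  std_simplex I x -> (forall l, l \in I -> u 0 l <= m) -> dot u x <= m.
Proof.
case=> c [c0 c1 ->] um; rewrite dot_sumr -[leRHS]mul1r -c1 mulr_suml.
by apply: ler_sum => l lI; rewrite dotZr dot_delta ler_wpM2l ?c0 ?um.
Qed.

Lemma argmax_std_simplexP I u x : argmax (std_simplex I) u x <->
  std_simplex I x /\ forall l, l \in I -> u 0 l <= dot u x.
Proof.
split=> -[Ix xmax]; split=> //; last by move=> y Iy; apply: dot_std_simplex_le Iy xmax.
move=> l lI.
by rewrite -dot_delta; apply: xmax; apply: delta_std_simplex.
Qed.

Lemma argmax_delta I u i :
  i \in I -> argmax (std_simplex I) u (delta_mx 0 i) <-> i \in top I u.
Proof.
move=> iI; rewrite argmax_std_simplexP dot_delta.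
split=> [[_ h]|/topP[_ h]]; first exact/topP.
by split=> //; apply: delta_std_simplex.
Qed.

(** A face of a simplex is spanned by its vertices, so inclusion of faces can be tested on
    vertices. *)
Lemma argmax_std_simplex_subset I u v : I != finset.set0 ->
  argmax (std_simplex I) u `<=` argmax (std_simplex I) v <->
  top I u \subset top I v.
Proof.
move=> I0; split=> [uv|/fintype.subsetP uv x].
  apply/fintype.subsetP => i iu; have /topP[iI _] := iu.
  by apply/argmax_delta => //; apply: uv; apply/argmax_delta.
case/argmax_std_simplexP=> Ix xmax; apply/argmax_std_simplexP; split=> //.
have [i iu] := top_neq0 u I0.
have /topP[iI imax] := iu; have /topP[_ imaxv] := uv _ iu.
case: Ix xmax => c [c0 c1 ex] xmax.
have ux : dot u x = u 0 i.
  apply/le_anti; rewrite xmax // andbT.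
  by apply: dot_std_simplex_le imax; exists c.
suff -> : dot v x = v 0 i by [].
(* A vanishing sum of nonnegative terms: the weights [c] are supported on [top I u], where [v] is
   constant. *)
have cu : \sum_(l in I) c l * (u 0 i - u 0 l) = 0.
  under eq_bigr do rewrite mulrBr.
  rewrite big_split /= -mulr_suml c1 mul1r sumrN -ux ex dot_sumr.
  by under [X in _ - X]eq_bigr do rewrite -dot_delta -dotZr; rewrite subrr.
rewrite ex dot_sumr -[RHS]mul1r -c1 mulr_suml; apply: eq_bigr => l lI.
rewrite dotZr dot_delta.
have : c l * (u 0 i - u 0 l) == 0.
  apply/eqP; apply: (psumr_eq0P _ cu lI) => k kI.
  by rewrite mulr_ge0 ?c0 ?subr_ge0 ?imax.
rewrite mulf_eq0 subr_eq0 => /orP[/eqP->|/eqP ul]; first by rewrite !mul0r.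
have /uv/topP[_ lmaxv] : l \in top I u.
  by apply/topP; split=> // k kI; rewrite -ul imax.
by congr (_ * _); apply/le_anti; rewrite imaxv // lmaxv.
Qed.

Definition top_cone (S : {set {set 'I_n}}) u : set 'rV[R]_n :=
  [set v | forall I, I \in S -> top I u \subset top I v].

Lemma outer_normal_fan_simplex_sum (S : {set {set 'I_n}}) :
    finset.set0 \notin S ->
  outer_normal_fan (minkowski_sum S (@std_simplex R n)) = range (top_cone S).
Proof.
move=> S0; have neq0 I : I \in S -> I != finset.set0.
  by apply: contraTneq => ->.
rewrite outer_normal_fan_minkowski_sum => [|I w /neq0 /(top_neq0 w)[i iw]].
  apply: eq_imagel => u _; apply/seteqP; split=> v uv I IS.
    by apply/(argmax_std_simplex_subset u v (neq0 I IS)); apply: uv.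
  by apply/(argmax_std_simplex_subset u v (neq0 I IS)); apply: uv.
have /topP[iI _] := iw.
by exists (delta_mx 0 i); apply/(argmax_delta w iI).
Qed.

End SimplexSums.

(** * Faces of cones cut out by comparisons of coordinates *)

Section OrderCones.
Variables (R : realType) (n : nat) (Q : 'I_n -> 'I_n -> Prop).
Implicit Types u v w : 'rV[R]_n.

Definition order_cone : set 'rV[R]_n :=
  [set v : 'rV[R]_n | forall a b, Q a b -> v 0 b <= v 0 a].

(** For [u] in the cone this is the smallest face containing [u]. *)
Definition tight_face u : set 'rV[R]_n :=
  [set v : 'rV[R]_n | order_cone v /\
     forall a b, Q a b -> u 0 a = u 0 b -> v 0 a = v 0 b].

Lemma order_coneD u v : order_cone u -> order_cone v -> order_cone (u + v).
Proof. by move=> Cu Cv a b ab; rewrite !mxE lerD ?Cu ?Cv. Qed.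

Lemma order_cone0 : order_cone 0.
Proof. by move=> a b _; rewrite !mxE. Qed.

Lemma order_cone_sum (T : finType) (f : T -> 'rV[R]_n) :
  (forall t, order_cone (f t)) -> order_cone (\sum_t f t).
Proof.
by move=> Cf; elim/big_ind: _ => // [|u v]; [apply: order_cone0 | apply: order_coneD].
Qed.

Lemma tight_face_argmax u : order_cone u ->
  exists w, tight_face u = argmax order_cone w.
Proof.
move=> Cu; pose T (p : 'I_n * 'I_n) := `[<Q p.1 p.2 /\ u 0 p.1 = u 0 p.2>].
(* The sum of the outer normals of the inequalities tight at [u]: it is nonpositive on the cone and
   zero exactly where all of them are tight. *)
pose w : 'rV[R]_n := \sum_(p | T p) (delta_mx 0 p.2 - delta_mx 0 p.1).
have wE v : dot w v = \sum_(p | T p) (v 0 p.2 - v 0 p.1).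
  by rewrite dotC dot_sumr; apply: eq_bigr => p _; rewrite dotBr !dot_delta.
have wle v : order_cone v -> dot w v <= 0.
  move=> Cv; rewrite wE; apply: sumr_le0 => p /asboolP[Qp _].
  by rewrite subr_le0 Cv.
exists w; apply/seteqP; split=> v [Cv h]; split=> //.
  move=> y Cy; rewrite [leRHS]wE big1 ?wle // => p /asboolP[Qp up].
  by rewrite (h _ _ Qp up) subrr.
move=> a b Qab uab; have w0 : dot w v = 0.
  by apply/le_anti; rewrite wle //= -(dot0r w); apply/h/order_cone0.
have s0 : \sum_(p | T p) (v 0 p.1 - v 0 p.2) = 0.
  transitivity (- dot w v); last by rewrite w0 oppr0.
  by rewrite wE -sumrN; apply: eq_bigr => p _; rewrite opprB.
apply/eqP; rewrite -subr_eq0; apply/eqP.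
apply: (psumr_eq0P _ s0 (i := (a, b))) => [p /asboolP[Qp _]|]; last exact/asboolP.
by rewrite subr_ge0 Cv.
Qed.

(** The point [u] is in the relative interior of its tight face, so a large multiple of it absorbs
    the subtraction of [v]. The constant is the sum of all slack ratios, which dominates each of
    them; pairs with [u 0 a = u 0 b] contribute 0. *)
Lemma order_cone_absorb u v : order_cone u -> tight_face u v ->
  exists N : R, order_cone (N *: u - v).
Proof.
move=> Cu [Cv uv]; pose c (a b : 'I_n) := `|v 0 a - v 0 b| / `|u 0 a - u 0 b|.
have c0 a b : 0 <= c a b by rewrite divr_ge0.
exists (\sum_a \sum_b c a b) => a b Qab; rewrite !mxE.
have [uab|nuab] := eqVneq (u 0 a) (u 0 b); first by rewrite uab (uv a b).
have lt_ba : 0 < u 0 a - u 0 b.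
  by rewrite subr_gt0 lt_neqAle eq_sym nuab Cu.
set N := \sum_a _; have cN : c a b <= N.
  rewrite /N (bigD1 a) //= (bigD1 b) //= -addrA lerDl addr_ge0 ?sumr_ge0 // => k _.
  exact: sumr_ge0.
have : v 0 a - v 0 b <= N * (u 0 a - u 0 b).
  apply: le_trans (ler_norm _) _; apply: le_trans (ler_wpM2r (ltW lt_ba) cN).
  by rewrite /c (gtr0_norm lt_ba) divfK // gt_eqF.
by lra.
Qed.

(** A relative interior point of the face is built by adding, for each pair, a point of the face
    where that comparison is strict, if there is one. The sum is tight only where the whole face
    is. *)
Lemma argmax_order_cone w : argmax order_cone w !=set0 ->
  exists2 u, order_cone u & argmax order_cone w = tight_face u.
Proof.
case=> x0 [Cx0 x0max].
have wle v : order_cone v -> dot w v <= 0.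
  move=> Cv; have := x0max _ (order_coneD Cx0 Cv).
  by rewrite dotDr gerDl.
have FE v : argmax order_cone w v <-> order_cone v /\ dot w v = 0.
  split=> [[Cv vmax]|[Cv v0]]; last by split=> // y /wle; rewrite v0.
  split=> //; apply/le_anti; rewrite wle //= -(dot0r w).
  exact/vmax/order_cone0.
have /choice[g gP] : forall p : 'I_n * 'I_n, exists y, argmax order_cone w y /\
    forall v, argmax order_cone w v -> v 0 p.2 < v 0 p.1 -> y 0 p.2 < y 0 p.1.
  move=> p; have [[y yF yp]|no] :=
    pselect (exists2 v, argmax order_cone w v & v 0 p.2 < v 0 p.1).
    by exists y.
  exists 0; split=> [|v vF vp]; last by case: no; exists v.
  by apply/FE; split; [apply: order_cone0 | apply: dot0r].
have Cg p : order_cone (g p) by case: (gP p) => -[].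
have w0 p : dot w (g p) = 0 by case: (gP p) => /FE[].
exists (\sum_p g p); first exact: order_cone_sum.
have wu : dot w (\sum_p g p) = 0 by rewrite dot_sumr big1.
apply/seteqP; split=> v.
  move=> Fv; case/FE: (Fv) => Cv v0; split=> // a b Qab.
  rewrite !summxE => uab; apply/eqP; rewrite eq_le (Cv a b Qab) andbT leNgt.
  apply/negP => vab; have : \sum_p g p 0 b < \sum_p g p 0 a.
    rewrite (bigD1 (a, b)) //= [ltRHS](bigD1 (a, b)) //= ltr_leD //.
      by case: (gP (a, b)) => _ /(_ v Fv vab).
    by apply: ler_sum => p _; apply: Cg.
  by rewrite uab ltxx.
move=> uv; case: (uv) => Cv _; apply/FE; split=> //.
(* As [w] vanishes on the interior point and is nonpositive on the cone, it cannot be negative on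
   [v]. *)
have [N /wle] := order_cone_absorb (order_cone_sum Cg) uv.
rewrite dotBr dotZr wu mulr0 sub0r oppr_le0 => v0.
by apply/le_anti; rewrite v0 wle.
Qed.

Lemma faces_order_cone : faces order_cone = tight_face @` order_cone.
Proof.
apply/seteqP; split=> [F [F0 [w ew]]|_ [u Cu <-]].
  move: F0; rewrite ew => /argmax_order_cone[u Cu ->].
  exact: imageP.
have [w ew] := tight_face_argmax Cu; split; last by exists w.
by exists u.
Qed.

End OrderCones.

(** Membership in the cone says that top vertices for [u0] stay top, which is a family of
    comparisons [Q]. The tight face of a point [u] of the cone is then the normal cone of [u]. *)
Lemma faces_top_cone (R : realType) n (S : {set {set 'I_n}}) (u0 : 'rV[R]_n) :
  finset.set0 \notin S -> faces (top_cone S u0) = top_cone S @` top_cone S u0.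
Proof.
move=> S0; pose Q a b := exists I, [/\ I \in S, a \in top I u0 & b \in I].
have coneE : top_cone S u0 = order_cone Q.
  apply/seteqP; split=> [v u0v a b [I [IS /(fintype.subsetP (u0v I IS))/topP[_ aI] bI]]|].
    exact: aI.
  move=> v Cv I IS; apply/fintype.subsetP => a au0; have /topP[aI _] := au0.
  by apply/topP; split=> // b bI; apply: Cv; exists I.
rewrite coneE faces_order_cone; apply: eq_imagel => u.
rewrite -coneE => u0u; apply/seteqP; split=> v.
  case=> Cv uv I IS; apply/fintype.subsetP => l lu; have /topP[lI lmax] := lu.
  have /(top_neq0 u0)[a au0] : I != finset.set0 by apply: contraNneq S0 => <-.
  have /topP[aI amax] := fintype.subsetP (u0u I IS) a au0.
  apply/topP; split=> // b bI.
  rewrite -(uv a l); [|by exists I|by apply/le_anti; rewrite lmax // amax].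
  by apply: Cv; exists I.
move=> uv; split=> [|a b [I [IS au0 bI]] uab].
  by rewrite -coneE => I IS; apply: fintype.subset_trans (u0u I IS) (uv I IS).
have /topP[aI amax] := fintype.subsetP (u0u I IS) a au0.
have /(fintype.subsetP (uv I IS))/topP[_ avmax] : a \in top I u by apply/topP.
have /(fintype.subsetP (uv I IS))/topP[_ bvmax] : b \in top I u.
  by apply/topP; split=> // k kI; rewrite -uab amax.
by apply/le_anti; rewrite avmax // bvmax.
Qed.

(** * Permutations and removed walls *)

Section Ranks.
Variable n : nat.
Implicit Types (s t : 'S_n) (i j x y : 'I_n) (a b w : seq 'I_n).

Definition rank s x : nat := (s^-1)%g x.

Lemma rank_inj s : injective (rank s).
Proof. by move=> x y /val_inj/perm_inj. Qed.

Lemma rank_perm s (k : 'I_n) : rank s (s k) = k.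
Proof. by rewrite /rank permK. Qed.

Lemma index_codom_perm s x : index x (codom s) = rank s x.
Proof.
rewrite -{1}(permKV s x) /codom /image_mem index_map ?index_enum_ord //.
exact: perm_inj.
Qed.

Lemma codom_perm_uniq s : uniq (codom s).
Proof. by rewrite map_inj_uniq ?enum_uniq //; apply: perm_inj. Qed.

Lemma codom_perm_inj : injective (fun s => codom s).
Proof.
move=> s t st; apply: invg_inj; apply/permP => x; apply: val_inj.
by rewrite -[LHS]index_codom_perm -[RHS]index_codom_perm st.
Qed.

Lemma perm_of_word w : uniq w -> size w = n -> exists s, codom s = w.
Proof.
move=> uw sw; have f_inj : injective (fun k : 'I_n => nth k w k).
  move=> k l /=; rewrite (set_nth_default l) ?sw // => /eqP.
  by rewrite nth_uniq ?sw // => /eqP/val_inj.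
exists (perm f_inj); case: w uw sw f_inj => [|x0 w] uw sw f_inj.
  by apply: size0nil; rewrite /codom size_image card_ord -sw.
apply: (@eq_from_nth _ x0) => [|k]; rewrite size_image card_ord ?sw // => kn.
rewrite (nth_map (Ordinal kn)) ?size_enum_ord // permE nth_enum_ord //.
by apply: set_nth_default; rewrite sw.
Qed.

(** One suffix [r] serves all rearrangements of [w], so the resulting words differ only in the
    prefix. *)
Lemma perm_of_prefix w : uniq w ->
  exists r, forall w', perm_eq w' w -> exists s : 'S_n, codom s = w' ++ r.
Proof.
move=> uw; exists [seq x <- enum 'I_n | x \notin w] => w' ww'.
have pe : perm_eq (w' ++ [seq x <- enum 'I_n | x \notin w]) (enum 'I_n).
  apply: uniq_perm; rewrite ?enum_uniq // ?cat_uniq.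
    rewrite (perm_uniq ww') uw filter_uniq ?enum_uniq // andbT.
    by apply/hasPn => x; rewrite mem_filter (perm_mem ww') => /andP[].
  by move=> x; rewrite mem_cat mem_filter (perm_mem ww') mem_enum andbT orbN.
by apply: perm_of_word; rewrite ?(perm_uniq pe) ?enum_uniq // (perm_size pe) size_enum_ord.
Qed.

Lemma swap_perm t a b i j : codom t = a ++ [:: j; i] ++ b ->
  exists t' : 'S_n, codom t' = a ++ [:: i; j] ++ b.
Proof.
move=> et; have pe : perm_eq (codom t) (a ++ [:: i; j] ++ b).
  by rewrite et perm_cat2l (perm_catCA [:: j] [:: i] b).
apply: perm_of_word; first by rewrite -(perm_uniq pe) codom_perm_uniq.
by rewrite -(perm_size pe) size_image card_ord.
Qed.

(** This turns an adjacent transposition into arithmetic on positions; the last clause also records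
    that all other nodes avoid the two swapped positions. *)
Lemma swapped_ranks s t a b i j :
    codom s = a ++ [:: i; j] ++ b -> codom t = a ++ [:: j; i] ++ b ->
  [/\ i != j,
      forall x, (x \in a) = (rank s x < size a)%N,
      rank s i = size a /\ rank s j = (size a).+1,
      rank t j = size a /\ rank t i = (size a).+1 &
      forall x, [\/ x = i, x = j |
        [/\ rank t x = rank s x, x != i, x != j, rank s x != size a &
          rank s x != (size a).+1]]].
Proof.
move=> es et; have := codom_perm_uniq s; rewrite es cat_uniq /= => /and3P[_ /norP[ia]].
case/norP=> ja _ /andP[]; rewrite inE negb_or => /andP[ij _] _.
have rE (u : 'S_n) l c d : codom u = a ++ [:: c; d] ++ l -> forall x,
    rank u x = (if x \in a then index x a else size a + index x [:: c, d & l])%N.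
  by move=> eu x; rewrite -index_codom_perm eu index_cat.
have rs := rE s _ _ _ es; have rt := rE t _ _ _ et.
rewrite !rs !rt (negbTE ia) (negbTE ja) /= !eqxx (negbTE ij) eq_sym (negbTE ij).
split=> [||||x]; rewrite ?addn0 ?addn1 //.
  move=> x; rewrite rs; case: ifP => xa; first by rewrite index_mem.
  by rewrite ltnNge leq_addr.
have [->|xi] := eqVneq x i; first by apply: Or31.
have [->|xj] := eqVneq x j; first by apply: Or32.
apply: Or33; rewrite rs rt /= !(eq_sym _ x) (negbTE xi) (negbTE xj).
split=> //; case: ifP => [|_]; rewrite -?index_mem.
- by move/ltn_eqF ->.
- by rewrite gtn_eqF // -[ltnLHS]addn0 ltn_add2l.
- by move=> xa; rewrite ltn_eqF // ltnW.
- by rewrite gtn_eqF // -addn1 ltn_add2l.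
Qed.

Definition inversions s t : {set 'I_n * 'I_n} :=
  [set p | (rank s p.1 < rank s p.2)%N && (rank t p.2 < rank t p.1)%N]%SET.

(** If each adjacent pair of the word of [t] were in the order of [s], the word would be sorted by
    [rank s] and equal that of [s]. *)
Lemma descent s t : s != t -> exists a b i j,
  codom t = a ++ [:: j; i] ++ b /\ (rank s i < rank s j)%N.
Proof.
move=> st; pose le_s : rel 'I_n := fun x y => (rank s x <= rank s y)%N.
have tr_s : transitive le_s by move=> y x z; apply: leq_trans.
have sorted_s : sorted le_s (codom s).
  case e: (codom s) => [//|x0 l]; rewrite -e; apply/(sortedP x0) => k.
  rewrite size_image card_ord => kn; rewrite /le_s -!index_codom_perm.
  by rewrite !index_uniq ?codom_perm_uniq ?size_image ?card_ord // ltnW.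
have : ~~ sorted le_s (codom t).
  apply: contra st => sorted_t; apply/eqP/codom_perm_inj.
  apply: (sorted_eq tr_s) => // [x y /anti_leq/rank_inj //|].
  apply: uniq_perm; rewrite ?codom_perm_uniq // => x.
  by rewrite -!index_mem !size_image !index_codom_perm card_ord !ltn_ord.
case e: (codom t) => [//|x0 l]; rewrite -e => nsorted.
have [k [kn nle]] : exists k, (k.+1 < size (codom t))%N /\
    ~~ le_s (nth x0 (codom t) k) (nth x0 (codom t) k.+1).
  apply: contrapT => h; move/negP: nsorted; apply; apply/(sortedP x0) => k kn.
  by apply: contrapT => /negP nle; apply: h; exists k.
exists (take k (codom t)), (drop k.+2 (codom t)).
exists (nth x0 (codom t) k.+1), (nth x0 (codom t) k); split.
  by rewrite /= -!drop_nth ?cat_take_drop // ltnW.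
by rewrite ltnNge.
Qed.

Lemma inversions_swap s t t' a b i j :
    codom t = a ++ [:: j; i] ++ b -> codom t' = a ++ [:: i; j] ++ b ->
  (rank s i < rank s j)%N -> (#|inversions s t'| < #|inversions s t|)%N.
Proof.
move=> et et' sij; have [ji _ [tj ti] [t'i t'j] tt'] := swapped_ranks et et'.
apply: proper_card; apply/properP; split.
  apply/fintype.subsetP => -[x y]; rewrite !inE /= => /andP[sxy txy].
  rewrite sxy /=.
  by case: (tt' x) sxy txy => [->|->|[-> _ _ ? ?]];
    case: (tt' y) => [->|->|[-> _ _ ? ?]]; lia.
exists (i, j); rewrite !inE /= ?sij ?tj ?ti ?t'i ?t'j; lia.
Qed.

End Ranks.

(** * Cones of the [S_n] fan *)

Section PermCones.
Variables (R : realType) (n : nat).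
Implicit Types (s t : 'S_n) (u v : 'rV[R]_n) (I : {set 'I_n}).

(* An interior point of the cone of [s]. *)
Definition perm_vector s : 'rV[R]_n := \row_x - (rank s x)%:R.

Lemma perm_vectorE s x : perm_vector s 0 x = - (rank s x)%:R.
Proof. by rewrite mxE. Qed.

Lemma top_perm_vectorP I s x :
  reflect (x \in I /\ forall l, l \in I -> (rank s x <= rank s l)%N)
          (x \in top I (perm_vector s)).
Proof.
apply: (iffP (topP _ _ _)) => -[xI h]; split=> // l /h;
by rewrite !perm_vectorE lerN2 ler_nat.
Qed.

Lemma top_perm_vector_eq I s x y :
  x \in top I (perm_vector s) -> y \in top I (perm_vector s) -> x = y.
Proof.
move=> /top_perm_vectorP[xI hx] /top_perm_vectorP[yI hy].
by apply: (@rank_inj _ s); apply/eqP; rewrite eqn_leq hx ?hy.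
Qed.

(** Both sides are singletons, because ranks are distinct. *)
Lemma top_perm_vector_subset I s t : I != finset.set0 ->
    top I (perm_vector s) \subset top I (perm_vector t) ->
  top I (perm_vector s) = top I (perm_vector t).
Proof.
move=> /(top_neq0 (perm_vector s))[x xs] /fintype.subsetP st.
apply/setP/subset_eqP/andP; split; apply/fintype.subsetP => // y yt.
by rewrite -(top_perm_vector_eq (st x xs) yt).
Qed.

Lemma perm_coneP s v :
  perm_cone s v <-> forall x y, (rank s x <= rank s y)%N -> v 0 y <= v 0 x.
Proof.
split=> [sv x y xy|sv k l kl]; last by apply: sv; rewrite !rank_perm.
by have := sv _ _ xy; rewrite !permKV.
Qed.

Lemma perm_vector_in_cone s : perm_cone s (perm_vector s).
Proof. by apply/perm_coneP => x y xy; rewrite !perm_vectorE lerN2 ler_nat. Qed.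

Lemma perm_cone_vector s t : perm_cone t (perm_vector s) -> t = s.
Proof.
move=> /perm_coneP ts; apply/eqP; rewrite eq_sym; apply: contrapT => /negP.
case/descent=> a [b [i [j [et ij]]]].
have [t' et'] := swap_perm et.
have [_ _ [tj ti] _ _] := swapped_ranks et et'.
have /ts : (rank t j <= rank t i)%N by rewrite tj ti.
by rewrite !perm_vectorE lerN2 ler_nat leqNgt ij.
Qed.

Lemma perm_cone_top s v I : perm_cone s v ->
  top I (perm_vector s) \subset top I v.
Proof.
move=> /perm_coneP sv; apply/fintype.subsetP => x /top_perm_vectorP[xI h].
by apply/topP; split=> // l /h /sv.
Qed.

(** The nodes are sorted by decreasing coordinate of [v], with ties broken by [s]; the tie-breaking
    keeps [t] in the class of [s] later on. *)
Lemma perm_cone_sort s v : exists2 t, perm_cone t v &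
  forall x y, v 0 y < v 0 x \/ v 0 x = v 0 y /\ (rank s x <= rank s y)%N ->
    (rank t x <= rank t y)%N.
Proof.
pose le_v : rel 'I_n := fun x y =>
  (v 0 y < v 0 x) || ((v 0 x == v 0 y) && (rank s x <= rank s y)%N).
have tr_v : transitive le_v.
  rewrite /le_v => y x z /orP[xy|/andP[/eqP xy rxy]] /orP[yz|/andP[/eqP yz ryz]].
  - by rewrite (lt_trans yz xy).
  - by rewrite -yz xy.
  - by rewrite xy yz.
  - by rewrite xy yz eqxx (leq_trans rxy ryz) orbT.
have tot_v : total le_v.
  by move=> x y; rewrite /le_v; case: ltgtP => //= _; apply: leq_total.
have anti_v x y : le_v x y -> le_v y x -> x = y.
  rewrite /le_v; case: ltgtP => //= _ xy yx.
  by apply: (@rank_inj _ s); apply/eqP; rewrite eqn_leq xy.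
have [t et] : exists t : 'S_n, codom t = sort le_v (enum 'I_n).
  by apply: perm_of_word; rewrite ?sort_uniq ?enum_uniq // size_sort size_enum_ord.
have le_vP x y : (rank t x <= rank t y)%N -> le_v x y.
  rewrite -!index_codom_perm et; apply: (sorted_leq_index tr_v).
  - by move=> z; rewrite /le_v eqxx leqnn orbT.
  - exact: sort_sorted.
  - by rewrite mem_sort mem_enum.
  - by rewrite mem_sort mem_enum.
exists t.
  apply/perm_coneP => x y /le_vP /orP[/ltW //|/andP[/eqP -> _]]; exact: lexx.
move=> x y xy; rewrite leqNgt; apply/negP => yx.
have le_xy : le_v x y by rewrite /le_v; case: xy => [->|[-> ->]]; rewrite ?eqxx ?orbT.
by have := anti_v _ _ le_xy (le_vP _ _ (ltnW yx)) => e; rewrite e ltnn in yx.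
Qed.

Lemma perm_cone_cover v : exists s, perm_cone s v.
Proof. by have [t tv _] := perm_cone_sort 1%g v; exists t. Qed.

End PermCones.

(** * Classes of permutations and maximal cones for a sum of simplices *)

Section SimplexRelations.
Variables (R : realType) (n : nat) (S : {set {set 'I_n}}).
Hypothesis S0 : finset.set0 \notin S.
Implicit Types (s t : 'S_n) (v : 'rV[R]_n).

(* The walls that are not walls of the normal fan of the sum of the simplices
   indexed by [S]. *)
Definition simplex_relations : set (relation_triple n) :=
  [set t | is_relation t /\ let: (i, j, K) := t in
     forall I, I \in S -> i \in I -> j \in I -> ~~ [disjoint I & K]].

Definition same_tops s t : Prop := forall I, I \in S ->
  top I (perm_vector R s) = top I (perm_vector R t).

(** Swapping [i] and [j] could change the first element of [I] only if [I] contains both and misses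
    [a], which the relation forbids. *)
Lemma removed_wall_simplex_relations s t :
  removed_wall simplex_relations s t -> same_tops s t.
Proof.
case=> a [b [i [j [es et [_ Mij]]]]] I IS.
apply: top_perm_vector_subset; first by apply: contraNneq S0 => <-.
have [ij ra [si sj] [tj ti] st] := swapped_ranks es et.
apply/fintype.subsetP => x /top_perm_vectorP[xI xmin].
apply/top_perm_vectorP; split=> // l lI; have := xmin l lI.
have [/andP[iI jI]|nij] := boolP ((i \in I) && (j \in I)).
  have := Mij I IS iI jI; rewrite -setI_eq0 => /set0Pn[z].
  rewrite !inE ra => /andP[zI za]; have := xmin z zI.
  by case: (st x) => [->|->|[-> _ _ ? ?]]; case: (st l) => [->|->|[-> _ _ ? ?]]; lia.
by case: (st x) xI => [->|->|[-> _ _ ? ?]] xI;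
  case: (st l) lI => [->|->|[-> _ _ ? ?]] lI;
  rewrite ?xI ?lI // in nij; lia.
Qed.

(** Induction on inversions: a descent of [t] relative to [s] is undone by crossing a removed
    wall. *)
Lemma same_tops_clos s t :
  same_tops s t -> clos_refl_sym_trans _ (removed_wall simplex_relations) s t.
Proof.
have [m] := ubnP #|inversions s t|; elim: m => // m IH in t * => lt_m st.
have [->|] := eqVneq s t; first exact: rst_refl.
case/descent=> a [b [i [j [et ij]]]].
have [t' et'] := swap_perm et.
have tt' : removed_wall simplex_relations t' t.
  exists a, b, i, j; split=> //.
  have [ij' ra [ti tj] _ _] := swapped_ranks et' et.
  have [_ ra' [tj' ti'] _ _] := swapped_ranks et et'.
  split; first by split; rewrite ?inE ?ra ?ti ?tj -?leqNgt.
  move=> I IS iI jI; apply/negP => /pred0P Ia.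
  (* If [I] avoided [a], then [j] would be first in [I] for [t], hence for [s], although [i]
     precedes [j] in [s]. *)
  have /top_perm_vectorP[_ /(_ i iI)] : j \in top I (perm_vector R s).
    rewrite st //; apply/top_perm_vectorP; split=> // l lI.
    by rewrite tj' leqNgt -ra'; apply/negP => la; have := Ia l; rewrite /= lI inE la.
  by rewrite leqNgt ij.
apply: rst_trans (rst_step _ _ _ _ tt'); apply: IH.
  exact: leq_trans (inversions_swap et et' ij) _.
by move=> I IS; rewrite st // (removed_wall_simplex_relations tt').
Qed.

Lemma clos_simplex_relations s t :
  clos_refl_sym_trans _ (removed_wall simplex_relations) s t <-> same_tops s t.
Proof.
split; last exact: same_tops_clos.
elim=> [s' t'|//|s' t' _ IH I IS|s' t' r' _ IH1 _ IH2 I IS].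
- exact: removed_wall_simplex_relations.
- by rewrite IH.
- by rewrite IH1 ?IH2.
Qed.

Lemma coarsened_cone_simplex_relations s :
  coarsened_cone simplex_relations s = top_cone S (perm_vector R s).
Proof.
apply/seteqP; split=> v.
  case=> t /clos_simplex_relations st tv I IS.
  by rewrite st //; apply: perm_cone_top.
move=> sv; have [t tv tle] := perm_cone_sort s v.
exists t => //; apply/clos_simplex_relations => I IS.
apply: top_perm_vector_subset; first by apply: contraNneq S0 => <-.
apply/fintype.subsetP => x xs; have /top_perm_vectorP[xI sx] := xs.
have /topP[_ vx] := fintype.subsetP (sv I IS) x xs.
apply/top_perm_vectorP; split=> // l lI; apply: tle.
by have := vx l lI; rewrite le_eqVlt => /orP[/eqP ->|]; [right|left]; rewrite ?sx.
Qed.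

Lemma coarsened_fan_top_cone (M : set (relation_triple n)) :
    (forall s, coarsened_cone M s = top_cone S (perm_vector R s)) ->
  coarsened_fan M = range (@top_cone R n S).
Proof.
move=> MS; apply/seteqP; split=> [F [s _]|_ [u _ <-]].
  by rewrite MS faces_top_cone // => -[u _ <-]; exists u.
have [s su] := perm_cone_cover u; exists s => //.
rewrite MS faces_top_cone //; exists u => // I IS.
exact: perm_cone_top.
Qed.

Lemma outer_normal_fan_simplex_relations :
  outer_normal_fan (minkowski_sum S (@std_simplex R n)) =
  coarsened_fan simplex_relations.
Proof.
rewrite outer_normal_fan_simplex_sum // (@coarsened_fan_top_cone simplex_relations) //.
exact: coarsened_cone_simplex_relations.
Qed.

Lemma perm_cone_sub_coarsened_cone M s :
  perm_cone s `<=` @coarsened_cone R n M s.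
Proof. by move=> v sv; exists s => //; apply: rst_refl. Qed.

Lemma faces_self (P : set 'rV[R]_n) : P !=set0 -> faces P P.
Proof.
move=> P0; split=> //; exists 0.
apply/seteqP; split=> [x Px|x []] //; split=> // y _.
by rewrite dotC dot0r dotC dot0r.
Qed.

(* The cone of [s] has nonempty interior, so the only cone of the normal fan
   that contains it is a maximal one. *)
Lemma coarsened_cone_of_fan_eq M :
    outer_normal_fan (minkowski_sum S (@std_simplex R n)) = coarsened_fan M ->
  forall s, coarsened_cone M s = top_cone S (perm_vector R s).
Proof.
rewrite outer_normal_fan_simplex_sum // => fanE s.
have sM : coarsened_cone M s (perm_vector R s).
  by apply: perm_cone_sub_coarsened_cone; apply: perm_vector_in_cone.
have : coarsened_fan M (@coarsened_cone R n M s).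
  by exists s => //; apply: faces_self; exists (perm_vector R s).
rewrite -fanE => -[u _ ue]; move: sM; rewrite -ue => us.
have top_eq I : I \in S -> top I u = top I (perm_vector R s).
  move=> IS; apply/setP/subset_eqP; rewrite us //=.
  have /(top_neq0 u)[x xu] : I != finset.set0 by apply: contraNneq S0 => <-.
  apply/fintype.subsetP => y ys; have xs := fintype.subsetP (us I IS) x xu.
  by rewrite (top_perm_vector_eq ys xs).
by apply/seteqP; split=> v uv I IS; have := uv I IS; rewrite top_eq.
Qed.

(** The fan determines the classes of permutations, since [perm_vector R t] lies in no permutation
    cone but that of [t]. It is not yet shown to determine the set of walls. *)
Lemma clos_of_fan_eq M s t :
    outer_normal_fan (minkowski_sum S (@std_simplex R n)) = coarsened_fan M ->
  clos_refl_sym_trans _ (removed_wall M) s t <-> same_tops s t.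
Proof.
move=> /coarsened_cone_of_fan_eq coneE; split=> [st I IS|st].
  apply: top_perm_vector_subset; first by apply: contraNneq S0 => <-.
  have : coarsened_cone M s (perm_vector R t).
    by exists t => //; apply: perm_vector_in_cone.
  by rewrite coneE; apply.
have : coarsened_cone M s (perm_vector R t).
  by rewrite coneE => I IS; rewrite st.
by case=> t' st' /perm_cone_vector <-.
Qed.

End SimplexRelations.

Local Close Scope ring_scope.
Local Close Scope classical_set_scope.
Local Open Scope set_scope.

(** If [I] avoided [a], its first element would be [i] in [s] and [j] in [t]. *)
Lemma same_tops_swap (R : realType) n (S : {set {set 'I_n}}) (s t : 'S_n) a b i j :
    codom s = a ++ [:: i; j] ++ b -> codom t = a ++ [:: j; i] ++ b ->
  same_tops R S s t ->
  forall I, I \in S -> i \in I -> j \in I -> ~~ [disjoint I & [set x in a]%SET].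
Proof.
move=> es et st I IS iI jI; apply/negP => /pred0P Ia.
have [ij ra [si sj] _ _] := swapped_ranks es et.
have [_ _ [tj ti] _ _] := swapped_ranks et es.
have : i \in top I (perm_vector R s).
  apply/top_perm_vectorP; split=> // l lI; rewrite si leqNgt -ra.
  by apply/negP => la; have := Ia l; rewrite /= lI inE la.
by rewrite st // => /top_perm_vectorP[_ /(_ j jI)]; rewrite ti tj ltnn.
Qed.

(** * Minimal I-maps of orderings *)

Section Orderings.
Variables (n : nat) (G : rel 'I_n).
Implicit Types (s t : 'S_n) (x y : 'I_n).

Definition predecessors s y : {set 'I_n} := [set x | (rank s x < rank s y)%N]%SET.

(* The edges of the minimal I-map of the gaussoid for the ordering [s]. *)
Definition imap_edge s x y : Prop :=
  (rank s x < rank s y)%N /\ bayes_connected G (predecessors s y :\ x)%SET x y.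

Lemma removed_wall_sym s t :
  removed_wall (dag_gaussoid G) s t -> removed_wall (dag_gaussoid G) t s.
Proof.
case=> a [b [i [j [es et [[ij ia ja] nij]]]]]; exists a, b, j, i; split=> //.
split; first by split; rewrite // eq_sym.
by move=> /bayes_connected_sym.
Qed.

(* The intersection and contraction properties of d-separation. *)
Lemma removed_wall_imap_edge s t x y :
  removed_wall (dag_gaussoid G) s t -> imap_edge s x y -> imap_edge t x y.
Proof.
case=> a [b [i [j [es et [[_ ia ja] nij]]]]] [sxy cxy].
have [ij ra [si sj] [tj ti] st] := swapped_ranks es et.
have [yj|yj] := eqVneq y j.
  subst y; have xj : x != j by apply: contraTneq sxy => ->; rewrite ltnn.
  have [xi|xi] := eqVneq x i.
    subst x; case: nij; move: cxy; congr bayes_connected.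
    apply/setP => z; rewrite !inE ra.
    by case: (st z) => [->|->|[_ zi _ zi' _]]; rewrite ?eqxx ?zi ?si ?sj //; lia.
  split; first by case: (st x) xi xj sxy => [->|->|[-> _ _ ? ?]]; rewrite ?eqxx //; lia.
  (* In [t] the node [i] leaves the conditioning set. A walk last visiting [i] rather than [x] would
     connect [i] and [j] given [a]. *)
  have [] := bayes_connected_change (K1 := predecessors t j :\ x)
    (K2 := [set z in a]) (z := i) _ _ cxy => //.
  - move=> z zx zi; rewrite !inE zx /= sj tj.
    by case: (st z) => [zi'|->|[-> _ _ ? ?]]; rewrite ?sj ?tj;
      [rewrite zi' eqxx in zi|lia..].
  - move=> z zx zi; rewrite !inE zx /= sj ra.
    by case: (st z) => [zi'|->|[_ _ _ ? ?]]; rewrite ?sj ?tj;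
      [rewrite zi' eqxx in zi|lia..].
have [yi|yi] := eqVneq y i.
  subst y; have xi : x != i by apply: contraTneq sxy => ->; rewrite ltnn.
  have xj : x != j by apply: contraTneq sxy => ->; rewrite si sj ltnNge leqnSn.
  split; first by case: (st x) xi xj sxy => [->|->|[-> _ _ ? ?]]; rewrite ?eqxx //; lia.
  (* Here [j] joins the conditioning set, and a walk last visiting [j] is excluded in the same
     way. *)
  have [] := bayes_connected_change (K1 := predecessors t i :\ x)
    (K2 := [set z in a]) (z := j) _ _ cxy => // [z zx zj|z zx zj|/bayes_connected_sym//].
  - rewrite !inE zx /= si ti.
    by case: (st z) => [->|zj'|[-> _ _ ? ?]]; rewrite ?si ?ti;
      [lia|rewrite zj' eqxx in zj|lia].
  - rewrite !inE zx /= si ra.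
    by case: (st z) => [->|zj'|[_ _ _ ? ?]]; rewrite ?si ?ti;
      [lia|rewrite zj' eqxx in zj|lia].
have stE z : (rank t z < rank t y)%N = (rank s z < rank s y)%N.
  case: (st y) yi yj => [->|->|[-> _ _ ? ?]]; rewrite ?eqxx // => _ _.
  by case: (st z) => [->|->|[-> _ _ ? ?]]; rewrite ?si ?sj ?ti ?tj; lia.
split; first by rewrite stE.
by move: cxy; congr bayes_connected; apply/setP => z; rewrite !inE stE.
Qed.

Lemma clos_imap_edge s t x y :
  clos_refl_sym_trans _ (removed_wall (dag_gaussoid G)) s t ->
  imap_edge s x y <-> imap_edge t x y.
Proof.
elim=> [s' t' w|s' //|s' t' _ ->//|s' t' r' _ -> _ -> //].
by split; apply: removed_wall_imap_edge => //; apply: removed_wall_sym.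
Qed.
End Orderings.

(** * V-structures and simplex sums *)

Section Main.
Variables (n : nat) (G : rel 'I_n).
Hypothesis acyclicG : acyclic G.

Lemma fan_eq_no_v_structure (R : realType) (S : {set {set 'I_n}}) :
    finset.set0 \notin S ->
    outer_normal_fan (minkowski_sum S (@std_simplex R n))
      = coarsened_fan (dag_gaussoid G) ->
  ~ exists i j k, v_structure G i j k.
Proof.
move=> S0 fanE [i0 [j0 [k v0]]].
have [i [j [v gK kK]]] := v_structure_separated acyclicG v0.
move: (parents G j) gK kK => K gK kK; case: (v) => ij ik jk _; case: (gK) => -[_ iK jK] _.
have kNi : k != i.
  by apply: contraTneq ik => ->; apply: acyclic_connect.
have kNj : k != j.
  by apply: contraTneq jk => ->; apply: acyclic_connect.
(* Two pairs of words, each swapping [i] and [j]: after [K] in [s1], [s2], and after [K] and [k] in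
   [s3], [s4]. *)
have [|r words] := @perm_of_prefix _ (enum K ++ [:: i; j; k]).
  rewrite cat_uniq enum_uniq /= !inE !negb_or !mem_enum.
  rewrite (negbTE kK) (negbTE iK) (negbTE jK).
  by rewrite ij eq_sym kNi eq_sym kNj.
have [s1 e1] : exists s : 'S_n, codom s = enum K ++ [:: i; j] ++ k :: r.
  by have [s e] := words _ (perm_refl _); exists s; rewrite e -catA.
have [s2 e2] : exists s : 'S_n, codom s = enum K ++ [:: j; i; k] ++ r.
  rewrite catA; apply: words; rewrite perm_cat2l.
  by rewrite (perm_catCA [:: j] [:: i] [:: k]).
have [s3 e3] : exists s : 'S_n, codom s = (enum K ++ [:: k]) ++ [:: i; j] ++ r.
  rewrite -catA [[:: k] ++ _]catA catA; apply: words; rewrite perm_cat2l.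
  by rewrite (perm_catC [:: k] [:: i; j]).
have [s4 e4] : exists s : 'S_n, codom s = (enum K ++ [:: k]) ++ [:: j; i] ++ r.
  exact: swap_perm e3.
have Ka : [set x in enum K]%SET = K by apply/setP => x; rewrite inE mem_enum.
have st12 : same_tops R S s1 s2.
  apply/(clos_of_fan_eq S0 s1 s2 fanE)/rst_step.
  by exists (enum K), (k :: r), i, j; rewrite Ka.
(* Sets of [S] containing [i] and [j] meet [K] by the first pair, hence also meet [K] enlarged by
   [k]. *)
have st34 : same_tops R S s3 s4.
  apply: removed_wall_simplex_relations => //.
  exists (enum K ++ [:: k]), r, i, j; split=> //; split.
    by split; rewrite // inE mem_cat mem_enum inE eq_sym negb_or ?kNi ?kNj ?iK ?jK.
  move=> I IS iI jI; have := same_tops_swap e1 e2 st12 IS iI jI.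
  rewrite Ka; apply: contra.
  apply: disjointWr; apply/fintype.subsetP => x; rewrite !inE mem_cat mem_enum => ->.
  by [].
(* The collider [k] makes [i, j] an I-map edge for [s3]; it is none for [s4], where [j] precedes
   [i]. *)
have /(clos_of_fan_eq S0 s3 s4 fanE)/(@clos_imap_edge _ _ _ _ i j)[+ _] := st34.
have [_ ra3 [i3 j3] [j4 i4] st3] := swapped_ranks e3 e4.
case; rewrite ?i3 ?j3 ?i4 ?j4; last by move=> /ltnW; rewrite ltnn.
split; first by rewrite i3 j3.
have := v_structure_bayes_connected acyclicG K v; congr bayes_connected.
apply/setP => x; rewrite !inE j3 andbC.
have := ra3 x; rewrite mem_cat mem_enum inE orbC => xa.
case: (st3 x) => [->|->|[_ xi xj ? ?]].
- by rewrite eqxx andbF eq_sym (negbTE kNi) (negbTE iK).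
- by rewrite j3 ltnn eq_sym (negbTE kNj) (negbTE jK).
- by rewrite xi andbT xa; lia.
Qed.

(** This is the graphical building set of the skeleton; avoiding the complement of [I] confines
    walks to [I]. *)
Definition skeleton_connected_sets : {set {set 'I_n}} :=
  [set I : {set 'I_n} | (I != finset.set0) &&
    [forall x in I, forall y in I, connect (skeleton_avoiding G (~: I)%SET) x y]]%SET.

Hypothesis noV : forall i j k, ~ v_structure G i j k.

Lemma dag_gaussoid_separation :
  dag_gaussoid G = separation_relations (adjacent G).
Proof.
apply/seteqP; split=> -[[i j] K] [rel]; case: (rel) => _ iK jK nij; split=> //.
  move=> p pp lp; apply: contrapT => pK; apply: nij.
  apply/(bayes_connectedE noV iK jK); apply/connectP; exists p => //.
  rewrite path_skeleton_avoiding // pp; apply/allP => x xp; apply/negP => xK.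
  by apply: pK; exists x; rewrite // inE xp orbT.
move=> /(bayes_connectedE noV iK jK)/connectP[p].
rewrite path_skeleton_avoiding // => /andP[pp /allP pK] /esym lp.
have [x] := nij p pp lp; rewrite inE => /predU1P[->|/pK /negP //].
by rewrite (negbTE iK).
Qed.

Lemma dag_gaussoid_simplex :
  dag_gaussoid G = simplex_relations skeleton_connected_sets.
Proof.
apply/seteqP; split=> -[[i j] K] [rel]; case: (rel) => _ iK jK nij; split=> //.
  move=> I; rewrite inE => /andP[_ /forall_inP cI] iI jI; apply/negP => IK.
  apply: nij; apply/(bayes_connectedE noV iK jK).
  have /forall_inP/(_ j jI) := cI i iI.
  apply: connect_sub => a b /and3P[ab aI bI]; apply: connect1.
  rewrite !inE !negbK in aI bI.
  by rewrite /skeleton_avoiding /= ab !(disjointFr IK).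
move=> /(bayes_connectedE noV iK jK)/connectP[p].
rewrite path_skeleton_avoiding // => /andP[pp /allP pK] lp.
(* The nodes of a walk outside [K] form a connected set disjoint from [K]. *)
pose I := [set x in i :: p]%SET.
have iI : i \in I by rewrite !inE eqxx.
have jI : j \in I by rewrite lp inE mem_last.
have sym K' : connect_sym (skeleton_avoiding G K').
  apply: sym_connect_sym => a b.
  by rewrite /skeleton_avoiding /= adjacent_sym (andbC (a \notin _)).
have pI : path (skeleton_avoiding G (~: I)%SET) i p.
  rewrite path_skeleton_avoiding ?inE ?eqxx // pp; apply/allP => x xp.
  by rewrite !inE xp orbT.
have : I \in skeleton_connected_sets.
  rewrite inE; apply/andP; split; first by apply/set0Pn; exists i.
  apply/forall_inP => x; rewrite inE => /(path_connect pI) ix.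
  apply/forall_inP => y; rewrite inE => /(path_connect pI); apply: connect_trans.
  by rewrite sym.
move=> /nij/(_ iI jI)/negP; apply; apply/pred0P => x; rewrite /= !inE.
by apply/negP => /andP[/predU1P[->|/pK /negP //]]; rewrite (negbTE iK).
Qed.

Lemma separation_ascending (H : rel 'I_n) i j (K K' : {set 'I_n}) :
    separation_relations H (i, j, K) -> K \subset K' ->
    i \notin K' -> j \notin K' ->
  separation_relations H (i, j, K').
Proof.
case=> -[ij _ _] sep /fintype.subsetP KK' iK jK; split=> // p pp lp.
by have [x xp /KK' xK] := sep p pp lp; exists x.
Qed.

End Main.

Theorem proposition3p6 (R : realType) (n : nat) (G : rel 'I_n)
    (hG : acyclic G) :
  (is_MSS R G <-> ~ (exists i j k : 'I_n, v_structure G i j k)) /\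
  (~ (exists i j k : 'I_n, v_structure G i j k) <->
     is_undirected_model (dag_gaussoid G)).
Proof.
split; split.
- by case=> S S0 fanE; apply: (fan_eq_no_v_structure hG S0 fanE).
- move=> noV; have {}noV i j k : ~ v_structure G i j k.
    by move=> v; apply: noV; exists i, j, k.
  have S0 : finset.set0 \notin skeleton_connected_sets G.
    by rewrite inE eqxx.
  exists (skeleton_connected_sets G) => //.
  by rewrite dag_gaussoid_simplex //; apply: outer_normal_fan_simplex_relations.
- move=> noV; exists (adjacent G); split; first exact: adjacent_sym.
    move=> i; apply/negbTE; rewrite /adjacent /= orbb.
    exact: (acyclic_connect hG (connect0 _ _)).
  apply: dag_gaussoid_separation => i j k v; apply: noV; exists i, j, k; exact: v.
- case=> H [_ _ GH]; apply: (ascending_no_v_structure hG) => i j K K'.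
  by rewrite GH; apply: separation_ascending.
Qed.
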